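(* Let $\{\mathcal{C}_n\}$ be a sequence of binary linear codes with blocklengths $N_n\to\infty$ and rates $r_n\to r$ for some $r\in(0,1)$, such that the permutation group of each $\mathcal{C}_n$ is doubly transitive. Then $\{\mathcal{C}_n\}$ is capacity achieving on the BEC under bit-MAP decoding.
   Context: Binary linear codes $\mathcal{C}\subseteq\{0,1\}^N$ are assumed proper and of minimum distance at least $2$; rate $=K/N$. The permutation group of $\mathcal{C}$ is the set of permutations $\pi$ of the coordinates $[N]$ mapping every codeword to a codeword; it is doubly transitive if for all distinct $i,j,k\in[N]$ it contains $\pi$ with $\pi(i)=i$, $\pi(j)=k$. A uniformly random codeword $\underline{X}$ is sent over $\mathrm{BEC}(p)$ (each bit erased independently with probability $p$) giving $\underline{Y}$; $P_b(p)=\frac1N\sum_{i}\Pr(X_i\text{ is not uniquely determined by }\underline{Y})$. A sequence of codes with rates $r_n\to r\in(0,1)$ is capacity achieving on the BEC under bit-MAP decoding if $\lim_n P_b^{(n)}(p)=0$ for every $p\in[0,1-r)$. *)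

(* Defs.v *)
From mathcomp Require Import all_boot all_fingroup.
From Stdlib Require Import Reals.

Set Implicit Arguments.
Unset Strict Implicit.
Unset Printing Implicit Defensive.

Definition word (N : nat) := {ffun 'I_N -> bool}.
Definition code (N : nat) := {set word N}.

Definition zero_word (N : nat) : word N := [ffun _ => false].
Definition xor_word (N : nat) (x y : word N) : word N := [ffun i => xorb (x i) (y i)].

Definition linear_code (N : nat) (C : code N) : Prop :=
  zero_word N \in C /\ forall x y, x \in C -> y \in C -> xor_word x y \in C.

Definition weight (N : nat) (x : word N) : nat := #|[set i | x i]|.

Definition min_dist_ge2 (N : nat) (C : code N) : Prop :=
  forall x, x \in C -> x <> zero_word N -> (2 <= weight x)%N.

Definition proper_code (N : nat) (C : code N) : Prop :=
  forall i : 'I_N, exists2 x, x \in C & x i = true.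

(* dimension K with #|C| = 2^K, and rate K/N *)
Definition code_dim (N : nat) (C : code N) : nat := logn 2 #|C|.
Definition rate (N : nat) (C : code N) : R := (INR (code_dim C) / INR N)%R.

(* action of a coordinate permutation on a word: (pi x)_{pi j} = x_j *)
Definition perm_word (N : nat) (pi : {perm 'I_N}) (x : word N) : word N :=
  [ffun m => x ((pi^-1)%g m)].

Definition in_perm_group (N : nat) (C : code N) (pi : {perm 'I_N}) : Prop :=
  forall x, x \in C -> perm_word pi x \in C.

Definition doubly_transitive (N : nat) (C : code N) : Prop :=
  forall i j k : 'I_N, i <> j -> i <> k -> j <> k ->
    exists pi : {perm 'I_N}, in_perm_group C pi /\ pi i = i /\ pi j = k.

(* X_i is not uniquely determined by the BEC output with erasure set E
   when the codeword sent is x *)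
Definition bit_ambiguous (N : nat) (C : code N) (E : {set 'I_N}) (x : word N)
  (i : 'I_N) : bool :=
  [exists x' in C, [forall j, (j \notin E) ==> (x' j == x j)] && (x' i != x i)].

Definition Rsum (I : finType) (F : I -> R) : R := \big[Rplus/0%R]_(a : I) F a.

Definition erasure_prob (N : nat) (p : R) (E : {set 'I_N}) : R :=
  (p ^ #|E| * (1 - p) ^ (N - #|E|))%R.

Definition prob_bit_ambiguous (N : nat) (C : code N) (p : R) (i : 'I_N) : R :=
  Rsum (fun E : {set 'I_N} =>
    (erasure_prob p E * (INR #|[set x in C | bit_ambiguous C E x i]| / INR #|C|))%R).

Definition Pb (N : nat) (C : code N) (p : R) : R :=
  (/ INR N * Rsum (fun i : 'I_N => prob_bit_ambiguous C p i))%R.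

Definition capacity_achieving_BEC (Nn : nat -> nat) (C : forall n, code (Nn n)) (r : R) : Prop :=
  forall p : R, (0 <= p)%R -> (p < 1 - r)%R -> Un_cv (fun n => Pb (C n) p) 0%R.

(* Main.v *)
From HB Require Import structures.
Require Import Defs.
From mathcomp Require Import all_boot all_fingroup.
From Stdlib Require Import Reals Lra FunctionalExtensionality.

(** Let [h p] be the probability that a fixed bit is not determined by the
    other received bits (the EXIT function); by transitivity it does not depend
    on the bit.  The expected dimension of the subcode supported on the erased
    positions vanishes at [p = 0], equals the dimension [K] at [p = 1], and by
    Russo's formula has derivative [N h]; hence [(1 - p) h p <= K / N].
    The event defining [h] is increasing and, by double transitivity, its
    [N - 1] nontrivial influences are equal.  The Falik-Samorodnitsky argument
    (a log-Sobolev inequality applied to the martingale differences of the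
    indicator) then forces [h'] to be large wherever [h] is bounded away from
    [0] and [1], so [h] jumps from [e] to [1 - e] in a window of width [o(1)].
    If [h p >= e] for some [p < 1 - r], then [h > 1 - e] slightly to the right
    of [p], and the area bound contradicts [K / N --> r]. *)

Set Implicit Arguments.
Unset Strict Implicit.
Unset Printing Implicit Defensive.

(** * Real addition and multiplication as big-operator laws; finite real sums *)

HB.instance Definition _ := Monoid.isComLaw.Build R 0%R Rplus
  (fun x y z => esym (Rplus_assoc x y z)) Rplus_comm Rplus_0_l.

Local Open Scope R_scope.

HB.instance Definition _ := Monoid.isComLaw.Build R 1 Rmult
  (fun x y z => esym (Rmult_assoc x y z)) Rmult_comm Rmult_1_l.
HB.instance Definition _ := Monoid.isMulLaw.Build R 0 Rmult Rmult_0_l Rmult_0_r.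
HB.instance Definition _ := Monoid.isAddLaw.Build R Rmult Rplus
  Rmult_plus_distr_r (fun x y z => Rmult_plus_distr_l x y z).

Section FiniteSums.
Variable I : finType.
Implicit Types F G : I -> R.

Lemma eq_Rsum F G : F =1 G -> Rsum F = Rsum G.
Proof. by move=> eqFG; apply: eq_bigr => i _; apply: eqFG. Qed.

Lemma Rsum_scale c F : Rsum (fun i => c * F i) = c * Rsum F.
Proof.
rewrite /Rsum; elim/big_rec2: _ => [|i x y _ ->]; first by rewrite Rmult_0_r.
by rewrite Rmult_plus_distr_l.
Qed.

Lemma Rsum_add F G : Rsum (fun i => F i + G i) = Rsum F + Rsum G.
Proof. exact: big_split. Qed.

Lemma Rsum_sub F G : Rsum (fun i => F i - G i) = Rsum F - Rsum G.
Proof.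
have -> : Rsum F - Rsum G = Rsum F + (-1) * Rsum G by ring.
by rewrite -Rsum_scale -Rsum_add; apply: eq_Rsum => i; ring.
Qed.

Lemma Rsum_le F G : (forall i, F i <= G i) -> Rsum F <= Rsum G.
Proof.
move=> leFG; rewrite /Rsum; elim/big_rec2: _ => [|i x y _ lexy]; first lra.
by have := leFG i; lra.
Qed.

Lemma big_Rplus_const (P : pred I) c : \big[Rplus/0]_(i | P i) c = INR #|P| * c.
Proof.
rewrite big_const; elim: #|P| => [|n IHn] /=; first by rewrite Rmult_0_l.
by rewrite IHn -/(INR n.+1) S_INR; ring.
Qed.

Lemma derivable_pt_lim_Rsum (F : I -> R -> R) (F' : I -> R) x :
  (forall i, derivable_pt_lim (F i) x (F' i)) ->
  derivable_pt_lim (fun y => Rsum (F^~ y)) x (Rsum F').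
Proof.
move=> dF; rewrite /Rsum; elim: (index_enum I) => [|i s IHs].
  rewrite big_nil; apply: (derivable_pt_lim_ext (fun _ => 0)) => [y|].
    by rewrite big_nil.
  exact: derivable_pt_lim_const.
rewrite big_cons.
apply: (derivable_pt_lim_ext (F i + fun y => \big[Rplus/0]_(a <- s) F a y)%F).
  by move=> y; rewrite big_cons.
exact: derivable_pt_lim_plus.
Qed.

End FiniteSums.

Lemma Rsum_const_ord n c : Rsum (fun _ : 'I_n => c) = INR n * c.
Proof. by rewrite /Rsum big_Rplus_const card_ord. Qed.

Lemma exchange_Rsum (I J : finType) (F : I -> J -> R) :
  Rsum (fun i => Rsum (F i)) = Rsum (fun j => Rsum (F^~ j)).
Proof. exact: exchange_big. Qed.

(** Toggling [j] matches the sets that contain it with those that do not; this isolates one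
    coordinate of the cube. *)
Lemma Rsum_set_pair (T : finType) (j : T) (F : {set T} -> R) :
  Rsum F = \big[Rplus/0]_(E : {set T} | j \notin E) (F (j |: E) + F E).
Proof.
rewrite /Rsum (bigID (fun E : {set T} => j \in E)) /= big_split /=; congr (_ + _).
rewrite (reindex_onto (fun E => j |: E) (fun E => E :\ j)) /=; last first.
  by move=> E jE; rewrite setD1K.
apply: eq_bigl => E; rewrite setU11 /=.
apply/eqP/idP => [<-|jE]; first by rewrite setD11.
by rewrite setU1K.
Qed.

(** * Tangent bounds for [x * ln x] and inequalities on a two-point space *)

Section TwoPointInequalities.

Lemma ln_le_tangent x u : 0 < x -> 0 < u -> ln x <= ln u + x / u - 1.
Proof.
move=> x0 u0; have := exp_ineq1_le (ln (x / u)).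
have xu0 : 0 < x / u by apply: Rdiv_lt_0_compat.
rewrite exp_ln // /Rdiv ln_mult //; last exact: Rinv_0_lt_compat.
by rewrite ln_Rinv //; lra.
Qed.

(** Concavity of [ln], multiplied by [x]. At [x = 0] the factor [x] absorbs whatever value [ln 0]
    has. *)
Lemma xlnx_le_tangent x u : 0 <= x -> 0 < u -> x * ln x <= x * ln u + x * x / u - x.
Proof.
move=> x0 u0; case: (Rle_lt_or_eq_dec _ _ x0) => [xp|<-]; last first.
  by rewrite /Rdiv; lra.
have := Rmult_le_compat_l x _ _ x0 (ln_le_tangent xp u0); rewrite /Rdiv; lra.
Qed.

Lemma xlnx_ge_tangent x u : 0 <= x -> 0 < u -> x * ln x >= x * ln u + x - u.
Proof.
move=> x0 u0; case: (Rle_lt_or_eq_dec _ _ x0) => [xp|<-]; last lra.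
have := Rmult_le_compat_l x _ _ x0 (ln_le_tangent u0 xp).
have -> : x * (ln x + u / x - 1) = x * ln x + u - x by field; lra.
lra.
Qed.

(** This is the tangent bound for [x * ln x] at [x = Rabs d], multiplied by [2 * Rabs d]. *)
Lemma sqr_lnsqr_ge_tangent d u : 0 < u ->
  d * d * ln (d * d) >= 2 * (d * d) * ln u + 2 * (d * d) - 2 * u * Rabs d.
Proof.
move=> u0; have sqE : Rabs d * Rabs d = d * d by rewrite -Rabs_mult Rabs_pos_eq //; nra.
case: (Rle_lt_or_eq_dec _ _ (Rabs_pos d)) => [dp|d0]; last by rewrite -sqE -d0; lra.
rewrite -sqE ln_mult //.
have := xlnx_ge_tangent (Rlt_le _ _ dp) u0.
move: (Rabs d) dp => z zp H; nra.
Qed.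

Variable p : R.
Hypothesis p01 : 0 <= p <= 1.

(** Tangents at the mean [m] bound the entropy by the variance over [m]. Then [a - b] factors
    through square roots, and [p * (1 - p) * (sqrt a + sqrt b) ^ 2 <= 2 * m] gives a constant
    uniform in [p]. *)
Lemma two_point_log_sobolev a b : 0 <= a -> 0 <= b ->
  let m := p * a + (1 - p) * b in
  p * (a * ln a) + (1 - p) * (b * ln b) - m * ln m <= 2 * (sqrt a - sqrt b) ^ 2.
Proof.
move=> a0 b0 m; have m0 : 0 <= m by rewrite /m; nra.
case: (Rle_lt_or_eq_dec _ _ m0) => [mp|mz].
  have la := xlnx_le_tangent a0 mp; have lb := xlnx_le_tangent b0 mp.
  apply: (Rle_trans _ (p * (1 - p) * (a - b) ^ 2 / m)).
    apply: (Rle_trans _ (p * (a * ln m + a * a / m - a)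
      + (1 - p) * (b * ln m + b * b / m - b) - m * ln m)); first nra.
    right; rewrite {3 6}/m; have -> : p * (1 - p) * (a - b) ^ 2
      = p * (a * a) + (1 - p) * (b * b) - m * m by rewrite /m; ring.
    by rewrite {2}/m /m; field; rewrite -/m; lra.
  apply: (Rmult_le_reg_r m) => //; rewrite /Rdiv Rmult_assoc Rinv_l ?Rmult_1_r; last lra.
  have sa := sqrt_sqrt a a0; have sb := sqrt_sqrt b b0.
  rewrite /m -{1 3}sa -{1 3}sb.
  move: (sqrt a) (sqrt b) => x y.
  have -> : (x * x - y * y) ^ 2 = (x - y) ^ 2 * (x + y) ^ 2 by ring.
  have : p * (1 - p) * (x + y) ^ 2 <= 2 * (p * (x * x) + (1 - p) * (y * y)).
    have : p * (1 - p) * (x + y) ^ 2 <= 2 * (p * (1 - p) * (x * x + y * y)).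
      have : 0 <= p * (1 - p) * (x - y) ^ 2.
        by apply: Rmult_le_pos; [nra | apply: pow2_ge_0].
      lra.
    have := Rle_0_sqr (p * x); have := Rle_0_sqr ((1 - p) * y).
    rewrite /Rsqr; lra.
  have := pow2_ge_0 (x - y).
  nra.
(* A zero mean forces both weighted terms to vanish, so the left-hand side is zero. *)
have pa : p * a = 0 by rewrite /m in mz; nra.
have pb : (1 - p) * b = 0 by rewrite /m in mz; nra.
rewrite -mz -!Rmult_assoc pa pb; have := pow2_ge_0 (sqrt a - sqrt b); lra.
Qed.

(* The reverse triangle inequality for the L2 norm of a two-point space. *)
Lemma two_point_minkowski a b c d : 0 <= a -> 0 <= b -> 0 <= c -> 0 <= d ->
  (sqrt (p * a + (1 - p) * c) - sqrt (p * b + (1 - p) * d)) ^ 2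
  <= p * (sqrt a - sqrt b) ^ 2 + (1 - p) * (sqrt c - sqrt d) ^ 2.
Proof.
move=> a0 b0 c0 d0.
have sa := sqrt_sqrt a a0; have sb := sqrt_sqrt b b0.
have sc := sqrt_sqrt c c0; have sd := sqrt_sqrt d d0.
have u0 : 0 <= p * a + (1 - p) * c by nra.
have v0 : 0 <= p * b + (1 - p) * d by nra.
have su := sqrt_sqrt _ u0; have sv := sqrt_sqrt _ v0.
(* Expanding the squares leaves Cauchy-Schwarz, whose defect is
   [p * (1 - p) * (x * w - z * y) ^ 2]. *)
suff : p * (sqrt a * sqrt b) + (1 - p) * (sqrt c * sqrt d)
       <= sqrt (p * a + (1 - p) * c) * sqrt (p * b + (1 - p) * d) by nra.
apply: Rsqr_incr_0_var; last by apply: Rmult_le_pos; apply: sqrt_pos.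
rewrite Rsqr_mult !Rsqr_sqrt // -{2}sa -{2}sb -{2}sc -{2}sd /Rsqr.
move: (sqrt a) (sqrt b) (sqrt c) (sqrt d) => x y z w.
have : 0 <= p * (1 - p) * (x * w - z * y) ^ 2.
  by apply: Rmult_le_pos; [nra | apply: pow2_ge_0].
nra.
Qed.

End TwoPointInequalities.

(** * Conditional averages and the log-Sobolev inequality on the cube *)

Definition expect (N : nat) (p : R) (F : {set 'I_N} -> R) : R :=
  Rsum (fun E => erasure_prob p E * F E).

(** Forcing [j] in and out makes the value independent of whether [j] lies in [E], so conditional
    averages remain functions on the whole cube. *)
Definition avg (N : nat) (p : R) (j : 'I_N) (F : {set 'I_N} -> R) : {set 'I_N} -> R :=
  fun E => p * F (j |: E) + (1 - p) * F (E :\ j).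

Definition dif (N : nat) (j : 'I_N) (F : {set 'I_N} -> R) : {set 'I_N} -> R :=
  fun E => F (j |: E) - F (E :\ j).

Definition avgs (N : nat) (p : R) (s : seq 'I_N) (F : {set 'I_N} -> R) : {set 'I_N} -> R :=
  foldr (avg p) F s.

Section Expectation.
Variables (N : nat) (p : R).
Implicit Types (F G : {set 'I_N} -> R) (E : {set 'I_N}) (i j : 'I_N).

Lemma eq_expect F G : F =1 G -> expect p F = expect p G.
Proof. by move=> eqFG; apply: eq_Rsum => E; rewrite eqFG. Qed.

Lemma expect_add F G : expect p (fun E => F E + G E) = expect p F + expect p G.
Proof. by rewrite -Rsum_add; apply: eq_Rsum => E; ring. Qed.

Lemma expect_sub F G : expect p (fun E => F E - G E) = expect p F - expect p G.
Proof. by rewrite -Rsum_sub; apply: eq_Rsum => E; ring. Qed.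

Lemma expect_scale c F : expect p (fun E => c * F E) = c * expect p F.
Proof. by rewrite -Rsum_scale; apply: eq_Rsum => E; ring. Qed.

Lemma erasure_prob_setU1 j E : j \notin E ->
  erasure_prob p (j |: E) = p * (p ^ #|E| * (1 - p) ^ (N - #|E|).-1).
Proof.
by move=> jE; rewrite /erasure_prob cardsU1 jE add1n subnS /= Rmult_assoc.
Qed.

Lemma erasure_prob_notin j E : j \notin E ->
  erasure_prob p E = (1 - p) * (p ^ #|E| * (1 - p) ^ (N - #|E|).-1).
Proof.
move=> jE; have ltEN : (#|E| < N)%nat.
  by have := max_card (mem (j |: E)); rewrite cardsU1 jE card_ord.
rewrite /erasure_prob; have -> : (N - #|E|)%nat = (N - #|E|)%nat.-1.+1 by rewrite prednK ?subn_gt0.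
by rewrite /=; ring.
Qed.

Lemma setD1_notin j E : j \notin E -> E :\ j = E.
Proof.
by move=> jE; apply/setP => k; rewrite !inE; case: eqP => // ->; rewrite (negbTE jE).
Qed.

Lemma avg_notin j F E : j \notin E -> avg p j F E = p * F (j |: E) + (1 - p) * F E.
Proof. by move=> jE; rewrite /avg setD1_notin. Qed.

(** The remaining weight is the law of the other [N - 1] coordinates; the predecessor is genuine
    because [j \notin E]. *)
Lemma expect_pair j F : expect p F = \big[Rplus/0]_(E : {set 'I_N} | j \notin E)
  (p ^ #|E| * (1 - p) ^ (N - #|E|).-1 * avg p j F E).
Proof.
rewrite /expect (Rsum_set_pair j); apply: eq_bigr => E jE.
by rewrite erasure_prob_setU1 // (erasure_prob_notin jE) avg_notin //; ring.
Qed.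

Lemma setU1_setU1 j E : j |: (j |: E) = j |: E.
Proof. by rewrite setUA setUid. Qed.

Lemma setD1_setD1 j E : (E :\ j) :\ j = E :\ j.
Proof. by rewrite setDDl setUid. Qed.

Lemma setU1_setD1 j E : j |: (E :\ j) = j |: E.
Proof. by apply/setP => k; rewrite !inE; case: eqP. Qed.

Lemma setD1_setU1 j E : (j |: E) :\ j = E :\ j.
Proof. by apply/setP => k; rewrite !inE; case: eqP. Qed.

Lemma setD1_setU1_neq i j E : i <> j -> (j |: E) :\ i = j |: (E :\ i).
Proof.
move=> ij; apply/setP => k; rewrite !inE; case: (eqVneq k i) => // ->.
by move/eqP/negbTE: ij ->.
Qed.

Lemma setU1C i j E : i |: (j |: E) = j |: (i |: E).
Proof. by rewrite !setUA (setUC [set i]). Qed.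

Lemma setD1C i j E : (E :\ i) :\ j = (E :\ j) :\ i.
Proof. by rewrite !setDDl setUC. Qed.

Definition set1E := (setU1_setU1, setD1_setD1, setU1_setD1, setD1_setU1).

Lemma avg_avg j F : avg p j (avg p j F) = avg p j F.
Proof.
by apply: functional_extensionality => E; rewrite /avg !set1E; ring.
Qed.

Lemma avg_comm i j F : avg p i (avg p j F) = avg p j (avg p i F).
Proof.
apply: functional_extensionality => E; case: (eqVneq i j) => [->//|/eqP ij].
have ji : j <> i by move=> ji; apply: ij.
by rewrite /avg !setD1_setU1_neq // (setU1C i) (setD1C i); ring.
Qed.

Lemma expect_avg j F : expect p (avg p j F) = expect p F.
Proof. by rewrite !(expect_pair j) avg_avg. Qed.

Lemma avg_sub j F G :
  avg p j (fun E => F E - G E) = fun E => avg p j F E - avg p j G E.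
Proof. by apply: functional_extensionality => E; rewrite /avg; ring. Qed.

(* Pythagoras for the conditional expectation [avg p j]. *)
Lemma expect_sqr_avg j F : expect p (fun E => F E ^ 2) - expect p (fun E => avg p j F E ^ 2)
  = expect p (fun E => (F E - avg p j F E) ^ 2).
Proof.
rewrite -expect_sub -(expect_avg j) -[RHS](expect_avg j); apply: eq_expect => E.
by rewrite /avg !set1E; ring.
Qed.

Lemma avgs_comm i s F : avgs p s (avg p i F) = avg p i (avgs p s F).
Proof. by elim: s => //= j s ->; rewrite avg_comm. Qed.

Lemma avgs_sub s F G :
  avgs p s (fun E => F E - G E) = fun E => avgs p s F E - avgs p s G E.
Proof. by elim: s => //= j s ->; rewrite avg_sub. Qed.

Lemma expect_avgs s F : expect p (avgs p s F) = expect p F.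
Proof. by elim: s => //= j s; rewrite expect_avg. Qed.

Lemma avgs_invariant j s F E : j \in s -> avgs p s F (j |: E) = avgs p s F (E :\ j).
Proof.
elim: s E => //= i s IHs E; rewrite inE; case: (eqVneq j i) => [<- _|/eqP ji /= js].
  by rewrite /avg !set1E.
have ij : i <> j by move=> ij; apply: ji.
by rewrite /avg setU1C setD1C setD1_setU1_neq // IHs // IHs // setD1_setU1_neq.
Qed.

(** A function averaged over every coordinate is unchanged by deleting any element, so [E] can be
    emptied one element at a time. *)
Lemma avgs_enum_const F E : avgs p (enum 'I_N) F E = avgs p (enum 'I_N) F set0.
Proof.
move: {2}#|E| (erefl #|E|) => n; elim: n E => [|n IHn] E.
  by move/eqP; rewrite cards_eq0 => /eqP ->.
move=> cE; have [j jE] : exists j, j \in E by apply/set0Pn; rewrite -card_gt0 cE.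
rewrite -(setD1K jE) avgs_invariant ?mem_enum // setD1_setD1 IHn //.
by move: cE; rewrite (cardsD1 j) jE add1n => - [].
Qed.

Lemma expect_const c : expect p (fun _ : {set 'I_N} => c) = c.
Proof.
rewrite /expect (eq_Rsum (G := fun E => c * erasure_prob p E)); last by move=> E; ring.
rewrite Rsum_scale; suff -> : Rsum (@erasure_prob N p) = 1 by ring.
(* The total mass is the expansion over subsets of a product of [N] factors [p + (1 - p)]. *)
rewrite -[1](_ : \big[Rmult/1]_(i < N) (p + (1 - p)) = 1); last first.
  by rewrite big1 // => i _; ring.
rewrite bigA_distr; apply: eq_bigr => E _.
have powE (x : R) (P : pred 'I_N) : \big[Rmult/1]_(i | P i) x = x ^ #|P|.
  by rewrite big_const; elim: #|P| => //= n ->.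
rewrite (bigID (mem E)) /= /erasure_prob; congr (_ * _).
  by rewrite -(powE p (mem E)); apply: eq_bigr => i iE; rewrite (iE : i \in E).
have -> : (N - #|E|)%nat = #|~: E| by rewrite [RHS]cardsCs setCK card_ord.
rewrite -(powE _ (mem (~: E))); apply: eq_big => i.
  by rewrite -[LHS]/(i \in ~: E) inE.
by rewrite -[X in is_true X]/(i \in ~: E) inE => /negbTE ->.
Qed.

Hypothesis p01 : 0 <= p <= 1.

Lemma erasure_prob_ge0 E : 0 <= erasure_prob p E.
Proof. by apply: Rmult_le_pos; apply: pow_le; lra. Qed.

Lemma expect_le F G : (forall E, F E <= G E) -> expect p F <= expect p G.
Proof.
move=> leFG; apply: Rsum_le => E.
by apply: Rmult_le_compat_l => //; apply: erasure_prob_ge0.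
Qed.

Lemma expect_ge0 F : (forall E, 0 <= F E) -> 0 <= expect p F.
Proof. by move=> F0; rewrite -(expect_const 0); apply: expect_le. Qed.

Lemma avg_ge0 j F E : (forall E, 0 <= F E) -> 0 <= avg p j F E.
Proof.
move=> F0; have := F0 (j |: E); have := F0 (E :\ j); rewrite /avg; nra.
Qed.

Lemma avgs_ge0 s F E : (forall E, 0 <= F E) -> 0 <= avgs p s F E.
Proof. by move=> F0; elim: s E => //= j s IHs E; apply: avg_ge0. Qed.

Lemma expect_abs_avgs s F :
  expect p (fun E => Rabs (avgs p s F E)) <= expect p (fun E => Rabs (F E)).
Proof.
elim: s => [|j s IHs] /=; first exact: Rle_refl.
apply: Rle_trans IHs; rewrite -[X in _ <= X](expect_avg j); apply: expect_le => E.
rewrite /avg; apply: Rle_trans (Rabs_triang _ _) _.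
by rewrite !Rabs_mult (Rabs_pos_eq p) ?(Rabs_pos_eq (1 - p)); lra.
Qed.

Lemma dif_sqrt_avg_le i j F E : (forall E, 0 <= F E) ->
  dif i (fun E => sqrt (avg p j F E)) E ^ 2
    <= avg p j (fun E => dif i (fun E => sqrt (F E)) E ^ 2) E.
Proof.
move=> F0; case: (eqVneq i j) => [->|/eqP ij].
  rewrite {1}/dif {1 2}/avg !set1E Rminus_diag.
  by rewrite /= Rmult_0_l; apply: avg_ge0 => E'; nra.
have ji : j <> i by move=> ji; apply: ij.
rewrite /dif /avg (setU1C j i) (setD1C i j) !(setD1_setU1_neq _ ij) !(setD1_setU1_neq _ ji).
exact: two_point_minkowski.
Qed.

(** Each averaging step can only lower the energy of the square root, by the two-point Minkowski
    inequality. *)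
Lemma expect_dif_sqrt_avgs_le i s F : (forall E, 0 <= F E) ->
  expect p (fun E => dif i (fun E => sqrt (avgs p s F E)) E ^ 2)
    <= expect p (fun E => dif i (fun E => sqrt (F E)) E ^ 2).
Proof.
move=> F0; elim: s => [|j s IHs] /=; first exact: Rle_refl.
apply: Rle_trans IHs; rewrite -[X in _ <= X](expect_avg j); apply: expect_le => E.
by apply: dif_sqrt_avg_le => E'; apply: avgs_ge0.
Qed.

Lemma expect_xlnx_avg_le j F : (forall E, 0 <= F E) ->
  expect p (fun E => F E * ln (F E)) - expect p (fun E => avg p j F E * ln (avg p j F E))
    <= 2 * expect p (fun E => dif j (fun E => sqrt (F E)) E ^ 2).
Proof.
move=> F0; rewrite -(expect_avg j) -expect_sub -expect_scale.
by apply: expect_le => E; apply: two_point_log_sobolev.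
Qed.

(** Tensorization: the entropy telescopes over [s], each drop obeys the two-point inequality, and
    the energies of the partial averages are at most those of [F]. *)
Lemma log_sobolev_avgs s F : (forall E, 0 <= F E) ->
  expect p (fun E => F E * ln (F E)) - expect p (fun E => avgs p s F E * ln (avgs p s F E))
    <= 2 * \big[Rplus/0]_(j <- s) expect p (fun E => dif j (fun E => sqrt (F E)) E ^ 2).
Proof.
move=> F0; elim: s => [|j s IHs]; first by rewrite big_nil Rminus_diag; lra.
rewrite big_cons -[avgs p (j :: s) F]/(avg p j (avgs p s F)); have := expect_dif_sqrt_avgs_le j s F0.
have := expect_xlnx_avg_le j (fun E => avgs_ge0 s E F0); lra.
Qed.

Lemma avgs_enum F E : avgs p (enum 'I_N) F E = expect p F.
Proof.
rewrite -(expect_avgs (enum 'I_N)) avgs_enum_const -[LHS]expect_const.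
by apply: eq_expect => E'; rewrite (avgs_enum_const _ E').
Qed.

Lemma expect_avgs_enum (f : R -> R) F :
  expect p (fun E => f (avgs p (enum 'I_N) F E)) = f (expect p F).
Proof. by rewrite -[RHS]expect_const; apply: eq_expect => E; rewrite avgs_enum. Qed.

(** The tensorized bound for [F * F], whose square root is [Rabs (F E)]; taking absolute values does
    not increase differences. *)
Lemma log_sobolev F :
  let m := expect p (fun E => F E * F E) in
  expect p (fun E => F E * F E * ln (F E * F E)) - m * ln m
    <= 2 * Rsum (fun j => expect p (fun E => dif j F E ^ 2)).
Proof.
move=> m; have F0 E : 0 <= F E * F E by nra.
have := log_sobolev_avgs (enum 'I_N) F0.
rewrite [X in _ - X](expect_avgs_enum (fun x => x * ln x)) big_enum -/m => /Rle_trans; apply.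
apply: Rmult_le_compat_l; first lra.
apply: Rsum_le => j; apply: expect_le => E; rewrite /dif.
rewrite -!/(Rsqr (F _)) !sqrt_Rsqr_abs -!Rsqr_pow2.
apply: Rsqr_le_abs_1; exact: Rabs_triang_inv2.
Qed.

(** An L1 norm small against the L2 norm forces large entropy, at least [m * ln (m / a ^ 2)]. The
    parameter [t] makes this bound linear in [m], so that it can be summed over martingale
    differences. *)
Lemma entropy_lower_bound F a t : 0 < a -> 0 < t -> expect p (fun E => Rabs (F E)) <= a ->
  let m := expect p (fun E => F E ^ 2) in
  m * (ln t + 1) - t * a ^ 2 <= 2 * Rsum (fun j => expect p (fun E => dif j F E ^ 2)).
Proof.
move=> a0 t0 Fa m; have := log_sobolev F.
have -> : expect p (fun E => F E * F E) = m by apply: eq_expect => E; ring.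
have m0 : 0 <= m by apply: expect_ge0 => E; apply: pow2_ge_0.
case: (Rle_lt_or_eq_dec _ _ m0) => [mp|<-] /=; last first.
  move=> _; have : 0 <= Rsum (fun j => expect p (fun E => dif j F E ^ 2)).
    rewrite -[X in X <= _](Rmult_0_r (INR N)) -Rsum_const_ord.
    by apply: Rsum_le => j; apply: expect_ge0 => E; apply: pow2_ge_0.
  have : 0 <= t * (a * (a * 1)) by apply: Rmult_le_pos; nra.
  rewrite /=; lra.
apply: Rle_trans.
(* With tangent point [m / a], the L1 term is at most [2 * m] and cancels the other linear term. *)
have u0 : 0 < m / a by apply: Rdiv_lt_0_compat.
have low : 2 * ln (m / a) * m + 2 * m - 2 * (m / a) * expect p (fun E => Rabs (F E))
    <= expect p (fun E => F E * F E * ln (F E * F E)).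
  rewrite -[2 * ln _ * m]expect_scale -[2 * m]expect_scale -expect_add -expect_scale -expect_sub.
  apply: expect_le => E; have := sqr_lnsqr_ge_tangent (F E) u0; rewrite /=; lra.
have : 2 * (m / a) * expect p (fun E => Rabs (F E)) <= 2 * m.
  have -> : 2 * m = 2 * (m / a) * a by field; lra.
  by apply: Rmult_le_compat_l; lra.
have lnma : ln (m / a) = ln m - ln a.
  by rewrite /Rdiv ln_mult ?ln_Rinv //; apply: Rinv_0_lt_compat.
(* The tangent to [x * ln x] at [t * a ^ 2] linearizes [m * ln m]. *)
have ta0 : 0 < t * (a * a) by apply: Rmult_lt_0_compat; nra.
have := xlnx_ge_tangent m0 ta0.
rewrite !ln_mult //; last nra.
rewrite lnma in low *; nra.
Qed.

(* With [d = F - avg p j F], the drops of [|F|^2] and of each [|dif i F|^2]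
   caused by [avg p j] are [|d|^2] and [|dif i d|^2], so the bound for [d]
   telescopes along [s]. *)
Lemma energy_drop_avgs a t s F : 0 < a -> 0 < t ->
  (forall j, expect p (fun E => Rabs (F E - avg p j F E)) <= a) ->
  let drop H := expect p (fun E => H F E ^ 2) - expect p (fun E => H (avgs p s F) E ^ 2) in
  drop (fun G => G) * (ln t + 1) - INR (size s) * (t * a ^ 2)
    <= 2 * Rsum (fun i => drop (@dif N i)).
Proof.
move=> a0 t0 Fa; elim: s => [|j s IHs] /=.
  rewrite (eq_Rsum (G := fun _ => 0)) ?Rsum_const_ord; first by rewrite /=; lra.
  by move=> i; ring.
rewrite -/(INR (size s).+1) S_INR; set g := avgs p s F in IHs *.
have da : expect p (fun E => Rabs (g E - avg p j g E)) <= a.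
  rewrite -avgs_comm /g; apply: Rle_trans (Fa j).
  apply: Rle_trans (expect_abs_avgs s _); right; apply: eq_expect => E.
  by rewrite avgs_sub.
have := entropy_lower_bound a0 t0 da; rewrite /= -[X in X * (ln t + 1)]expect_sqr_avg.
have -> : Rsum (fun i => expect p (fun E => dif i (fun E => g E - avg p j g E) E ^ 2)) =
  Rsum (fun i => expect p (fun E => dif i g E ^ 2) - expect p (fun E => dif i (avg p j g) E ^ 2)).
  (* For [i = j] the average has zero difference in direction [j]. Otherwise [dif i] commutes with
     [avg p j], and Pythagoras applies to [dif i g]. *)
  apply: eq_Rsum => i; case: (eqVneq i j) => [->|/eqP ij].
    rewrite -expect_sub; apply: eq_expect => E.
    by rewrite /dif /avg !set1E; ring.
  have ji : j <> i by move=> ji; apply: ij.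
  have difC : dif i (avg p j g) = avg p j (dif i g).
    apply: functional_extensionality => E.
    rewrite /dif /avg (setU1C j i) (setD1C i j).
    by rewrite !(setD1_setU1_neq _ ij) !(setD1_setU1_neq _ ji); ring.
  rewrite difC expect_sqr_avg -difC; apply: eq_expect => E.
  by rewrite /dif /avg; ring.
move: IHs; rewrite /= !Rsum_sub; lra.
Qed.

(** Averaging over all coordinates reaches the constant [expect p F], so the total L2 drop is the
    variance; the final energies are nonnegative and are dropped. *)
Lemma falik_samorodnitsky a t F : 0 < a -> 0 < t ->
  (forall j, expect p (fun E => Rabs (F E - avg p j F E)) <= a) ->
  (expect p (fun E => F E ^ 2) - expect p F ^ 2) * (ln t + 1) - INR N * (t * a ^ 2)
    <= 2 * Rsum (fun i => expect p (fun E => dif i F E ^ 2)).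
Proof.
move=> a0 t0 Fa.
have <- : expect p (fun E => avgs p (enum 'I_N) F E ^ 2) = expect p F ^ 2.
  exact: (expect_avgs_enum (fun x => x ^ 2)).
have := energy_drop_avgs (enum 'I_N) a0 t0 Fa; rewrite -cardE card_ord => H.
apply: Rle_trans H _.
apply: Rmult_le_compat_l; first lra.
apply: Rsum_le => i.
have : 0 <= expect p (fun E => dif i (avgs p (enum 'I_N) F) E ^ 2).
  by apply: expect_ge0 => E; apply: pow2_ge_0.
rewrite /=; lra.
Qed.

End Expectation.

(** * Russo's formula and monotone events *)

Section Russo.
Variable N : nat.
Implicit Types (F : {set 'I_N} -> R) (E : {set 'I_N}) (i j : 'I_N).

Lemma expect_dif_pair p j F : expect p (dif j F) =
  \big[Rplus/0]_(E : {set 'I_N} | j \notin E)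
    (p ^ #|E| * (1 - p) ^ (N - #|E|).-1 * (F (j |: E) - F E)).
Proof.
rewrite (expect_pair _ j); apply: eq_bigr => E jE; congr (_ * _).
by rewrite avg_notin // /dif !set1E setD1_notin //; ring.
Qed.

(** Differentiate the weights and regroup the sum of influences by erasure set. *)
Lemma russo F p :
  derivable_pt_lim (fun x => expect x F) p (Rsum (fun j => expect p (dif j F))).
Proof.
(* [w' E] is the derivative of the weight of [E], and [s j E] is the coefficient of [F E] in the
   [j]-th influence. Where a predecessor truncates at zero in [w'], the factor [INR 0] kills the
   term. *)
pose w' E := INR #|E| * p ^ #|E|.-1 * (1 - p) ^ (N - #|E|)
  - p ^ #|E| * (INR (N - #|E|) * (1 - p) ^ (N - #|E|).-1).
pose s j E := if j \in E then p ^ #|E|.-1 * (1 - p) ^ (N - #|E|)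
  else - (p ^ #|E| * (1 - p) ^ (N - #|E|).-1).
have -> : Rsum (fun j => expect p (dif j F)) = Rsum (fun E => w' E * F E).
  transitivity (Rsum (fun j => Rsum (fun E => s j E * F E))).
    apply: eq_Rsum => j; rewrite expect_dif_pair (Rsum_set_pair j).
    apply: eq_bigr => E jE; rewrite /s setU11 (negbTE jE) cardsU1 jE add1n subnS /=; ring.
  rewrite exchange_Rsum; apply: eq_Rsum => E.
  rewrite (eq_Rsum (G := fun j => F E * s j E)); last by move=> j; ring.
  rewrite Rsum_scale Rmult_comm; congr (_ * _).
  (* The [#|E|] indices inside [E] contribute the positive coefficient, the [N - #|E|] others the
     negative one. *)
  rewrite /Rsum (bigID (mem E)) /= (eq_bigr (fun _ => p ^ #|E|.-1 * (1 - p) ^ (N - #|E|))).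
    rewrite [X in _ + X](eq_bigr (fun _ => - (p ^ #|E| * (1 - p) ^ (N - #|E|).-1))).
      rewrite !big_Rplus_const /w'.
      have -> : #|(fun j => j \notin mem E)| = (N - #|E|)%nat.
        rewrite -[X in (X - _)%nat]card_ord -(cardC (mem E)) addKn; exact: eq_card.
      have -> : #|(fun j => mem E j)| = #|E| by apply: eq_card.
      ring.
    by move=> j jE; rewrite /s (negbTE jE).
  by move=> j jE; rewrite /s (jE : j \in E).
rewrite /expect; apply: derivable_pt_lim_Rsum => E.
have -> : w' E * F E = w' E * F E + erasure_prob p E * 0 by ring.
apply: (derivable_pt_lim_mult (fun x => erasure_prob x E) (fun _ => F E)); last first.
  exact: derivable_pt_lim_const.
rewrite /erasure_prob /w'.
have -> : INR #|E| * p ^ #|E|.-1 * (1 - p) ^ (N - #|E|)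
    - p ^ #|E| * (INR (N - #|E|) * (1 - p) ^ (N - #|E|).-1)
  = INR #|E| * p ^ #|E|.-1 * (1 - p) ^ (N - #|E|)
    + p ^ #|E| * (INR (N - #|E|) * (1 - p) ^ (N - #|E|).-1 * (0 - 1)) by ring.
apply: (derivable_pt_lim_mult (fun x => x ^ _) (fun x => (1 - x) ^ _)).
  exact: derivable_pt_lim_pow.
apply: (derivable_pt_lim_comp (fun x => 1 - x) (fun x => x ^ _)); last first.
  exact: derivable_pt_lim_pow.
apply: (derivable_pt_lim_minus (fun _ => 1) (fun x => x)).
  exact: derivable_pt_lim_const.
exact: derivable_pt_lim_id.
Qed.

Lemma expect1 F : expect 1 F = F [set: 'I_N].
Proof.
rewrite /expect /Rsum (bigD1 setT) //= big1 => [|E ET].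
  by rewrite /erasure_prob cardsT card_ord subnn pow1 /=; ring.
rewrite /erasure_prob Rminus_diag pow_i ?Rmult_0_r ?Rmult_0_l //.
apply/ltP; rewrite subn_gt0 -[X in (_ < X)%nat]card_ord -cardsT.
by apply: proper_card; rewrite properEneq ET subsetT.
Qed.

Lemma expect_perm p (pi : {perm 'I_N}) F :
  expect p F = expect p (fun E => F [set pi x | x in E]).
Proof.
rewrite {1}/expect /Rsum (reindex_inj (imset_inj (@perm_inj _ pi))).
by apply: eq_bigr => E _; rewrite /erasure_prob card_imset //; apply: perm_inj.
Qed.

End Russo.

Definition indic (b : bool) : R := if b then 1 else 0.

Lemma indic01 b : 0 <= indic b <= 1.
Proof. by case: b => /=; lra. Qed.

Section Monotone.
Variables (N : nat) (b : pred {set 'I_N}).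
Hypothesis b_mono : forall E E' : {set 'I_N}, E \subset E' -> b E -> b E'.
Let F E := indic (b E).

Lemma dif_indic01 j E : dif j F E = 0 \/ dif j F E = 1.
Proof.
rewrite /dif /F; have : E :\ j \subset j |: E.
  by apply/subsetP => k; rewrite !inE => /andP[_ ->]; rewrite orbT.
move/b_mono; case: (b (E :\ j)) => [->//|_]; first by left; apply: Rminus_diag.
by case: (b _); [right | left]; rewrite /=; ring.
Qed.

Variable p : R.
Hypothesis p01 : 0 <= p <= 1.

Lemma expect_dif_indic_ge0 j : 0 <= expect p (dif j F).
Proof. by apply: expect_ge0 => // E; case: (dif_indic01 j E) => ->; lra. Qed.

(** For a monotone indicator, [F - avg p j F] is a multiple of [dif j F] by a factor of modulus at
    most one. Squaring changes neither [F] nor [dif j F], so the variance is [h * (1 - h)] with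
    [h = expect p F], and the energies are the influences. *)
Lemma influence_bound a t : 0 < a -> 0 < t ->
  (forall j, expect p (dif j F) <= a) ->
  expect p F * (1 - expect p F) * (ln t + 1) - INR N * (t * a ^ 2)
    <= 2 * Rsum (fun j => expect p (dif j F)).
Proof.
move=> a0 t0 dFa.
have lapl j : expect p (fun E => Rabs (F E - avg p j F E)) <= a.
  apply: Rle_trans (dFa j); apply: expect_le => // E.
  case: (boolP (j \in E)) => jE.
    have -> : F E - avg p j F E = (1 - p) * dif j F E.
      by rewrite /avg /dif (setUidPr _) ?sub1set //; ring.
    by case: (dif_indic01 j E) => ->; rewrite ?Rmult_0_r ?Rabs_R0 ?Rmult_1_r ?Rabs_pos_eq; lra.
  have -> : F E - avg p j F E = - (p * dif j F E).
    by rewrite /avg /dif setD1_notin //; ring.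
  rewrite Rabs_Ropp.
  by case: (dif_indic01 j E) => ->; rewrite ?Rmult_0_r ?Rabs_R0 ?Rmult_1_r ?Rabs_pos_eq; lra.
have := falik_samorodnitsky p01 a0 t0 lapl.
have -> : expect p (fun E => F E ^ 2) = expect p F.
  by apply: eq_expect => E; rewrite /F; case: (b E) => /=; ring.
have -> : Rsum (fun j => expect p (fun E => dif j F E ^ 2)) = Rsum (fun j => expect p (dif j F)).
  by apply: eq_Rsum => j; apply: eq_expect => E; case: (dif_indic01 j E) => ->; ring.
by move=> H; apply: Rle_trans H; right; ring.
Qed.

End Monotone.

(** * EXIT functions of linear codes *)

Section Shortening.
Variables (N : nat) (C : code N).
Implicit Types (E : {set 'I_N}) (i j k : 'I_N).

Definition shorten E : code N := [set x in C | [forall j, x j ==> (j \in E)]].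

(* Bit [i] is not determined by the unerased bits other than itself; whether
   [i] belongs to the erasure set [E] is irrelevant. *)
Definition exit i E : bool := [exists x in shorten (i |: E), x i].

Lemma shortenP E (x : word N) :
  reflect (x \in C /\ forall j, x j -> j \in E) (x \in shorten E).
Proof.
rewrite inE; apply: (iffP andP) => -[xC xE]; split=> //.
  by move=> j; apply/implyP/(forallP xE).
by apply/forallP => j; apply/implyP/xE.
Qed.

Lemma shorten_setT : shorten [set: 'I_N] = C.
Proof.
by apply/setP => x; apply/shortenP/idP => [[]//|xC]; split=> // j; rewrite inE.
Qed.

Lemma exit_mono i E E' : E \subset E' -> exit i E -> exit i E'.
Proof.
move=> sEE' /existsP[x /andP[/shortenP[xC xE] xi]]; apply/existsP; exists x.
rewrite xi andbT; apply/shortenP; split=> // j /xE.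
by rewrite !inE => /orP[->//|/(subsetP sEE') ->]; rewrite orbT.
Qed.

Lemma dif_exit_self i E : dif i (fun E => indic (exit i E)) E = 0.
Proof. by rewrite /dif /exit !set1E Rminus_diag. Qed.

Lemma exit_perm (pi : {perm 'I_N}) i E : in_perm_group C pi ->
  exit i E -> exit (pi i) [set pi x | x in E].
Proof.
move=> Cpi /existsP[x /andP[/shortenP[xC xE] xi]].
apply/existsP; exists (perm_word pi x); rewrite ffunE permK xi andbT.
apply/shortenP; split=> [|j]; first exact: Cpi.
rewrite ffunE => /xE; rewrite -imsetU1 -{2}(permKV pi j) => jE.
exact: imset_f.
Qed.

(** The maps [f] and [g] stand for insertion or removal of a coordinate, or for the identity.
    Equalities come from using a permutation in each direction. *)
Lemma expect_exit_perm_le p (pi : {perm 'I_N}) i (f g : {set 'I_N} -> {set 'I_N}) :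
  0 <= p <= 1 -> in_perm_group C pi ->
  (forall E, [set pi x | x in f E] = g [set pi x | x in E]) ->
  expect p (fun E => indic (exit i (f E))) <= expect p (fun E => indic (exit (pi i) (g E))).
Proof.
move=> p01 Cpi fg; rewrite [X in _ <= X](expect_perm p pi).
apply: expect_le => // E; rewrite -fg.
case: (boolP (exit i (f E))) => [/(exit_perm Cpi) ->|_]; first exact: Rle_refl.
by have := indic01 (exit (pi i) [set pi x | x in f E]); rewrite /=; lra.
Qed.

Hypothesis C2 : doubly_transitive C.

Lemma expect_dif_exit p i j k : 0 <= p <= 1 -> i <> j -> i <> k ->
  expect p (dif j (fun E => indic (exit i E))) = expect p (dif k (fun E => indic (exit i E))).
Proof.
move=> p01 ij ik; rewrite /dif !expect_sub.
have le m n : i <> m -> i <> n ->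
    expect p (fun E => indic (exit i (m |: E))) <= expect p (fun E => indic (exit i (n |: E)))
    /\ expect p (fun E => indic (exit i (E :\ m))) <= expect p (fun E => indic (exit i (E :\ n))).
  move=> im iN; case: (eqVneq m n) => [->|/eqP mn]; first by split; apply: Rle_refl.
  have [pi [Cpi [pii pim]]] := C2 im iN mn.
  rewrite -{2 4}pii; split; apply: expect_exit_perm_le => // E.
    by rewrite imsetU1 pim.
  apply/setP => x; rewrite -(permKV pi x) -pim !(mem_imset, inE) ?(inj_eq perm_inj) //.
    exact: perm_inj.
  exact: perm_inj.
have [] := le j k ij ik; have [] := le k j ik ij; lra.
Qed.

(** Double transitivity moves [m] to [n] once a third coordinate [l] is available to be fixed, hence
    [2 < N]. *)
Lemma expect_exit_transitive p i k : 0 <= p <= 1 -> (2 < N)%nat ->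
  expect p (fun E => indic (exit i E)) = expect p (fun E => indic (exit k E)).
Proof.
move=> p01 N2.
have le m n : expect p (fun E => indic (exit m E)) <= expect p (fun E => indic (exit n E)).
  case: (eqVneq m n) => [->|/eqP mn]; first exact: Rle_refl.
  have [l] : exists l, l \in ~: [set m; n].
    apply/set0Pn; rewrite -card_gt0 cardsCs setCK card_ord subn_gt0.
    by apply: leq_ltn_trans N2; rewrite cards2; case: (m != n).
  rewrite !inE negb_or => /andP[/eqP lm /eqP ln].
  have [pi [Cpi [_ pim]]] := C2 lm ln mn.
  by rewrite -pim; apply: (@expect_exit_perm_le p pi m (fun E => E) (fun E => E)).
by have := le i k; have := le k i; lra.
Qed.

(** Bit [i] has zero influence and the other [N - 1] influences are equal, so each is at most
    [M / (INR N - 1)]. *)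
Lemma code_sharp_threshold p i M t : 0 <= p <= 1 -> (2 <= N)%nat -> 0 < M -> 0 < t ->
  let h := expect p (fun E => indic (exit i E)) in
  Rsum (fun j => expect p (dif j (fun E => indic (exit i E)))) <= M ->
  h * (1 - h) * (ln t + 1) <= 2 * M + 4 * t * M ^ 2 / INR N.
Proof.
move=> p01 N2 M0 t0 h; set I := fun j => expect p (dif j (fun E => indic (exit i E))) => IM.
have N2R : 2 <= INR N by apply: (le_INR 2); apply/leP.
have a0 : 0 < M / (INR N - 1) by apply: Rdiv_lt_0_compat; lra.
have Ii : I i = 0.
  by rewrite /I (eq_expect _ (dif_exit_self i)) expect_const.
have Ia j : I j <= M / (INR N - 1).
  case: (eqVneq i j) => [<-|/eqP ij]; first by rewrite Ii; lra.
  apply: (Rmult_le_reg_r (INR N - 1)); first lra.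
  have -> : M / (INR N - 1) * (INR N - 1) = M by field; lra.
  apply: Rle_trans IM; right.
  have : INR N * I j = I j + \big[Rplus/0]_(k < N | k != i) I j.
    by rewrite -Rsum_const_ord; apply: bigD1.
  have -> : Rsum I = \big[Rplus/0]_(k < N | k != i) I k.
    by rewrite /Rsum (bigD1 i) //= Ii Rplus_0_l.
  have -> : \big[Rplus/0]_(k < N | k != i) I k = \big[Rplus/0]_(k < N | k != i) I j.
    by apply: eq_bigr => k /eqP ki; apply: expect_dif_exit => // ik; apply: ki.
  lra.
have := influence_bound (exit_mono (i := i)) p01 a0 t0 Ia; rewrite -/h -/I.
(* The factor 4 comes from [INR N <= 2 * (INR N - 1)], squared. *)
have : INR N * (t * (M / (INR N - 1)) ^ 2) <= 4 * t * M ^ 2 / INR N.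
  apply: (Rmult_le_reg_r (INR N * (INR N - 1) ^ 2)).
    by apply: Rmult_lt_0_compat; [lra | apply: pow_lt; lra].
  have -> : INR N * (t * (M / (INR N - 1)) ^ 2) * (INR N * (INR N - 1) ^ 2)
    = t * M ^ 2 * INR N ^ 2 by field; lra.
  have -> : 4 * t * M ^ 2 / INR N * (INR N * (INR N - 1) ^ 2)
    = t * M ^ 2 * (2 * (INR N - 1)) ^ 2 by field; lra.
  apply: Rmult_le_compat_l; last by apply: pow_incr; lra.
  by apply: Rmult_le_pos; [lra | apply: pow2_ge_0].
lra.
Qed.

Hypothesis linC : linear_code C.

(** This links dimension to EXIT: allowing bit [i] raises the dimension by one exactly when some
    allowed codeword has that bit set. *)
Lemma dif_dim_shorten i E :
  dif i (fun E => INR (logn 2 #|shorten E|)) E = indic (exit i E).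
Proof.
have [C0 CD] := linC; set S := shorten (i |: E).
have SE : shorten (E :\ i) = [set x in S | ~~ x i].
  apply/setP => x; rewrite [RHS]inE; apply/shortenP/andP => [[xC xE]|[/shortenP[xC xE] xi]].
    split; last by apply/negP => /xE; rewrite setD11.
    by apply/shortenP; split=> // j /xE; rewrite !inE => /andP[_ ->]; rewrite orbT.
  split=> // j xj; have := xE j xj; rewrite !inE; case: eqP => // ji.
  by case/negP: xi; rewrite -ji.
have S0 : (0 < #|[set x in S | ~~ x i]|)%nat.
  apply/card_gt0P; exists (zero_word N); rewrite inE ffunE andbT.
  by apply/shortenP; split=> // j; rewrite ffunE.
rewrite /dif -/S SE /exit; case: (boolP [exists x in S, x i]) => [/existsP[y /andP[yS yi]]|nS].
  have [yC yE] := shortenP _ _ yS.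
  have xorK : cancel (xor_word y) (xor_word y).
    by move=> x; apply/ffunP => j; rewrite !ffunE; case: (y j); case: (x j).
  have xorS x : x \in S -> xor_word y x \in S.
    move=> /shortenP[xC xE]; apply/shortenP; split; first exact: CD.
    move=> j; rewrite ffunE; case yj: (y j); first by rewrite yE.
    by case xj: (x j) => // _; rewrite xE.
  (* Adding [y] exchanges the words of [S] with bit [i] set and those with it clear. *)
  have -> : #|S| = (2 * #|[set x in S | ~~ x i]|)%nat.
    rewrite -(cardsID [set x : word N | x i] S) mul2n -addnn; congr addn; last first.
      by apply: eq_card => x; rewrite !inE andbC.
    rewrite -(card_imset _ (can_inj xorK)); apply: eq_card => x.
    apply/imsetP/idP => [[z]|].
      rewrite in_setI => /andP[zS]; rewrite inE => zi ->.
      by rewrite inE xorS // ffunE yi; case: (z i) zi.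
    rewrite inE => /andP[xS xi]; exists (xor_word y x); last by rewrite xorK.
    by rewrite in_setI xorS // inE ffunE yi; case: (x i) xi.
  rewrite lognM // (_ : logn 2 2 = 1%nat) // add1n S_INR /indic; lra.
rewrite (_ : [set x in S | ~~ x i] = S) ?Rminus_diag //.
apply/setP => x; rewrite inE; case xS: (x \in S) => //=.
by apply: contra nS => xi; apply/existsP; exists x; rewrite xS.
Qed.

(** Two codewords that agree off [E] and differ at [i] have a sum witnessing [exit i E]; so the
    ambiguous fraction is zero unless [exit] holds, and never exceeds one. *)
Lemma prob_bit_ambiguous_bounds p i : 0 <= p <= 1 ->
  0 <= prob_bit_ambiguous C p i <= expect p (fun E => indic (exit i E)).
Proof.
have [C0 CD] := linC; move=> p01; have CR : 0 < INR #|C|.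
  by apply: (lt_INR 0); apply/ltP/card_gt0P; exists (zero_word N).
have amb E : 0 <= INR #|[set x in C | bit_ambiguous C E x i]| / INR #|C| <= indic (exit i E).
  split; first by apply: Rmult_le_pos; [apply: pos_INR | apply/Rlt_le/Rinv_0_lt_compat].
  case: (boolP (exit i E)) => [_|nex].
    apply: (Rmult_le_reg_r (INR #|C|)) => //.
    rewrite /Rdiv Rmult_assoc Rinv_l ?Rmult_1_r ?Rmult_1_l; last lra.
    by apply/le_INR/leP/subset_leq_card/subsetP => x; rewrite inE => /andP[].
  rewrite (_ : [set _ in _ | _] = set0) ?cards0 /=; first by rewrite /Rdiv Rmult_0_l; lra.
  apply/setP => x; rewrite !inE; apply/negP => /andP[xC /existsP[y /and3P[yC /forallP yx yi]]].
  case/negP: nex; apply/existsP; exists (xor_word y x); apply/andP; split; last first.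
    by rewrite ffunE; case: (y i) (x i) yi => -[].
  apply/shortenP; split; first exact: CD.
  move=> j; rewrite ffunE !inE; have := yx j; case: (j \in E); first by rewrite orbT.
  by move=> /eqP ->; case: (x j).
split.
  by apply: (@expect_ge0 N p) => // E; have := amb E; lra.
by apply: expect_le => // E; have := amb E; lra.
Qed.

End Shortening.

(** * Monotonicity, area bound and transition width of the EXIT function *)

Section Threshold.
Variables (N : nat) (C : code N).
Hypotheses (linC : linear_code C) (C2 : doubly_transitive C) (N2 : (2 < N)%nat).
Variable i : 'I_N.
Let h p := expect p (fun E => indic (exit C i E)).

Lemma exit_expect_incr p1 p2 : 0 <= p1 -> p1 <= p2 -> p2 <= 1 -> h p1 <= h p2.
Proof.
move=> p10 p12 p21; case: (Rle_lt_or_eq_dec _ _ p12) => [lt12|->]; last exact: Rle_refl.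
have [c [hc c12]] := MVT_cor2 h _ p1 p2 lt12 (fun c _ => russo (fun E => indic (exit C i E)) c).
have h'0 : 0 <= Rsum (fun j => expect c (dif j (fun E => indic (exit C i E)))).
  rewrite -[X in X <= _](Rmult_0_r (INR N)) -Rsum_const_ord; apply: Rsum_le => j.
  by apply: expect_dif_indic_ge0; [apply: exit_mono | lra].
suff : 0 <= h p2 - h p1 by lra.
by rewrite hc; apply: Rmult_le_pos => //; lra.
Qed.

(** The mean value theorem on [[p, 1]] replaces integration: the expected dimension grows by
    [N * h c * (1 - p)], is nonnegative at [p], and ends at the code dimension. *)
Lemma exit_area_le_rate p : 0 <= p < 1 -> h p * (1 - p) <= rate C.
Proof.
move=> p01; pose k (E : {set 'I_N}) := INR (logn 2 #|shorten C E|).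
have [c [kc cp]] := MVT_cor2 (fun x => expect x k) _ p 1 (proj2 p01) (fun c _ => russo k c).
have NR : 0 < INR N by apply: (lt_INR 0); apply/ltP/ltn_trans/N2.
have k'E : Rsum (fun j => expect c (dif j k)) = INR N * h c.
  rewrite -Rsum_const_ord; apply: eq_Rsum => j.
  rewrite (eq_expect _ (dif_dim_shorten linC j)).
  by apply: (expect_exit_transitive C2) => //; lra.
have hpc : h p <= h c by apply: exit_expect_incr; lra.
have kp0 : 0 <= expect p k by apply: expect_ge0; [lra | move=> E; apply: pos_INR].
apply: (Rmult_le_reg_r (INR N)) => //.
have -> : rate C * INR N = INR (code_dim C) by rewrite /rate; field; lra.
apply: (Rle_trans _ (INR N * h c * (1 - p))).
  have : 0 <= INR N * (1 - p) by apply: Rmult_le_pos; lra.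
  nra.
rewrite -k'E -kc expect1 {1}/k shorten_setT /code_dim; lra.
Qed.

Lemma Pb_bounds p : 0 <= p <= 1 -> 0 <= Pb C p <= h p.
Proof.
move=> p01; have NR : 0 < INR N by apply: (lt_INR 0); apply/ltP/ltn_trans/N2.
have bnd := fun j => prob_bit_ambiguous_bounds linC j p01.
have [s0 s1] : 0 <= Rsum (fun j => prob_bit_ambiguous C p j) <= INR N * h p.
  split.
    rewrite -[X in X <= _](Rmult_0_r (INR N)) -Rsum_const_ord; apply: Rsum_le => j.
    by have := bnd j; lra.
  rewrite -Rsum_const_ord; apply: Rsum_le => j.
  rewrite /h (expect_exit_transitive C2 i j) //.
  by have := bnd j; lra.
rewrite /Pb; split; first by apply: Rmult_le_pos => //; apply/Rlt_le/Rinv_0_lt_compat.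
apply: (Rmult_le_reg_l (INR N)) => //.
by rewrite -Rmult_assoc Rinv_r ?Rmult_1_l //; lra.
Qed.

(** Otherwise [h] stays in [[e, 1 - e]] throughout the window, yet its derivative is at most [1 / d]
    at some point there, against the sharp threshold bound. *)
Lemma exit_transition_width p d e : 0 <= p -> 0 < d -> p + d <= 1 -> 0 < e <= 1 / 2 ->
  4 * exp ((2 / d + 1) / (e * (1 - e))) * (1 / d) ^ 2 < INR N ->
  e <= h p -> 1 - e < h (p + d).
Proof.
move=> p0 d0 pd e01 bigN ehp; apply: Rnot_le_lt => hpd.
have ltpd : p < p + d by lra.
have [c [hc cpd]] := MVT_cor2 h _ p (p + d) ltpd (fun c _ => russo (fun E => indic (exit C i E)) c).
(* With this [t], the threshold bound has left side at least [2 / d + 1 + e * (1 - e)], while large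
   [N] keeps its right side below [2 / d + 1]. *)
set t := exp _ in bigN; have t0 : 0 < t := exp_pos _.
have M0 : 0 < 1 / d by apply: Rdiv_lt_0_compat; lra.
have hle p1 p2 : 0 <= p1 -> p1 <= p2 -> p2 <= 1 -> h p1 <= h p2 by apply: exit_expect_incr.
have h'M : Rsum (fun j => expect c (dif j (fun E => indic (exit C i E)))) <= 1 / d.
  apply: (Rmult_le_reg_r d) => //; have -> : 1 / d * d = 1 by field; lra.
  have -> : d = p + d - p by ring.
  rewrite -hc; lra.
have c01 : 0 <= c <= 1 by lra.
have := code_sharp_threshold C2 c01 (ltnW N2) M0 t0 h'M; rewrite -/(h c).
have hpc : h p <= h c by apply: hle; lra.
have hcd : h c <= h (p + d) by apply: hle; lra.
rewrite {1}/t ln_exp.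
have NR : 0 < INR N by apply: (lt_INR 0); apply/ltP/ltn_trans/N2.
have small : 4 * t * (1 / d) ^ 2 / INR N < 1.
  apply: (Rmult_lt_reg_r (INR N)) => //.
  by rewrite /Rdiv Rmult_assoc Rinv_l ?Rmult_1_r ?Rmult_1_l //; lra.
have ee0 : 0 < e * (1 - e) by apply: Rmult_lt_0_compat; lra.
have var : e * (1 - e) <= h c * (1 - h c) by nra.
set L := (2 / d + 1) / (e * (1 - e)).
have eeL : e * (1 - e) * L = 2 / d + 1 by rewrite /L; field; lra.
have L0 : 0 < L by apply: Rdiv_lt_0_compat => //; have := M0; lra.
have : e * (1 - e) * (L + 1) <= h c * (1 - h c) * (L + 1) by apply: Rmult_le_compat_r; lra.
have -> : 2 * (1 / d) = 2 / d by field; lra.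
lra.
Qed.

End Threshold.

Local Close Scope R_scope.

Theorem theorem3 (Nn : nat -> nat) (C : forall n, code (Nn n)) (r : R) :
  (0 < r < 1)%R ->
  (forall n, linear_code (C n)) ->
  (forall n, proper_code (C n)) ->
  (forall n, min_dist_ge2 (C n)) ->
  (forall M : nat, exists n0 : nat, forall n : nat, (n0 <= n)%N -> (M <= Nn n)%N) ->
  Un_cv (fun n => rate (C n)) r ->
  (forall n, doubly_transitive (C n)) ->
  capacity_achieving_BEC C r.
Proof.
move=> r01 linC _ _ Ninf rateC C2 p p0 pr eps eps0.
(* One third of the gap to capacity is the window; the other two thirds remain as
   [1 - (p + d) = r + 2 * d]. *)
pose d := ((1 - r - p) / 3)%R; have d0 : (0 < d)%R by rewrite /d; lra.
pose e := Rmin (eps / 2) d.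
have e0 : (0 < e)%R by apply: Rmin_glb_lt; lra.
have [e_eps e_d] : (e <= eps / 2 /\ e <= d)%R by split; [apply: Rmin_l | apply: Rmin_r].
have [m bigm] := INR_unbounded (4 * exp ((2 / d + 1) / (e * (1 - e))) * (1 / d) ^ 2).
(* Length 3 serves transitivity on single bits, and [m] the transition width. *)
have [n1 Nn1] := Ninf (maxn 3 m); have [n2 rate2] := rateC d d0.
exists (maxn n1 n2) => n /leP; rewrite geq_max => /andP[n1n /leP n2n].
have := Nn1 n n1n; rewrite geq_max => /andP[N3 mN].
have i : 'I_(Nn n) := Ordinal (ltn_trans (isT : 0 < 2) N3).
have p01 : (0 <= p <= 1)%R by lra.
have [Pb0 Pbh] := Pb_bounds (linC n) (C2 n) N3 i p01.
rewrite /Rdist Rminus_0_r Rabs_pos_eq //.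
apply: Rle_lt_trans Pbh _; apply: Rnot_le_lt => hp.
have d3 : (d <= 1 / 3)%R by rewrite /d; lra.
have bigN : (4 * exp ((2 / d + 1) / (e * (1 - e))) * (1 / d) ^ 2 < INR (Nn n))%R.
  by apply: Rlt_le_trans bigm _; apply/le_INR/leP.
have := exit_transition_width (C2 n) N3 p0 d0 _ _ bigN.
move=> /(_ i) width.
have {width} hpd : (1 - e < expect (p + d) (fun E => indic (exit (C n) i E)))%R.
  by apply: width; try lra; rewrite /d; lra.
have pd : (0 <= p + d < 1)%R by rewrite /d; lra.
have area := exit_area_le_rate (linC n) (C2 n) N3 i pd.
have := rate2 n n2n; rewrite /Rdist => /Rabs_def2 [up _].
have pdE : (1 - (p + d) = r + 2 * d)%R by rewrite /d; field.
rewrite pdE in area.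
have rd1 : (r + 2 * d <= 1)%R by rewrite /d; lra.
(* Since [e <= d] and [r + 2 * d <= 1], [(1 - e) * (r + 2 * d) >= r + d], whereas the area bound and
   the rate limit put it below [r + d]. *)
nra.
Qed.
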